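(* For $d\in\mathbb{N}$, the set $\mathfrak{V}_{\leq d}=\{r\in\mathbb{R}: VCdim(r)\leq d\}$ is uncountable if and only if $d\geq 2$.
   Context: Binary strings are indexed from $0$. For a finite binary string $s$, let $n(s)=\{i: s_i=1\}\subseteq\mathbb{N}$ (indices taken relative to $s$). For a (finite or right-infinite) binary string $S$, let $\mathfrak{S}=\{n(s): s \text{ a finite contiguous substring of } S\}$ (including the empty substring). A set $B\subseteq\mathbb{N}$ is shattered by $\mathfrak{S}$ if $\{c\cap B: c\in\mathfrak{S}\}$ is the full power set of $B$; $VCdim(S)$ is the largest size of a shattered set ($\infty$ if there is no largest). For a real number $r$, $VCdim(r)$ is the VC dimension of the binary string given by the base-2 representation of $r$, where for numbers with two representations the one ending in infinitely many zeros is chosen, and any binary point or negative sign is ignored. *)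

(* Defs.v *)
From HB Require Import structures.
From mathcomp Require Import all_boot all_order all_algebra.
From mathcomp Require Import all_classical all_reals.

Set Implicit Arguments.
Unset Strict Implicit.
Unset Printing Implicit Defensive.
Import Order.TTheory GRing.Theory Num.Theory.
Local Open Scope classical_set_scope.
Local Open Scope ring_scope.

(* Positions past the end of [s] read as [false], so they are never in [ones s]. *)
Definition ones (s : seq bool) : set nat := [set i | nth false s i].

(* The contiguous substring of length [n] of the right-infinite string [S]
   starting at position [i]; it is empty when [n = 0]. *)
Definition substring (S : nat -> bool) (i n : nat) : seq bool :=
  mkseq (fun k => S (i + k)%N) n.

Definition substring_class (S : nat -> bool) : set (set nat) :=
  [set c | exists i n, c = ones (substring S i n)].

Definition shattered (C : set (set nat)) (B : set nat) : Prop :=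
  [set c `&` B | c in C] = [set A | A `<=` B].

Definition shattered_sizes (C : set (set nat)) : set nat :=
  [set k | exists2 B : set nat, (B #= `I_k)%card & shattered C B].

Definition largest (A : set nat) : set nat :=
  [set k | A k /\ forall j, A j -> (j <= k)%N].

(* The values lie in the extended integers; [xget] returns its default [+oo]
   exactly when there is no largest size. *)
Definition VCdim (S : nat -> bool) : \bar int :=
  xget +oo%E [set (k%:Z)%:E | k in largest (shattered_sizes (substring_class S))].

Section BinaryExpansion.
Variable R : realType.
Implicit Types r : R.

(* The coefficient of [2 ^ k] in the base-2 expansion of [`|r|]; taking integer
   parts selects, for dyadic [r], the expansion ending in zeros. *)
Definition bit r (k : int) : bool := odd (Num.truncn (`|r| * 2 ^ (- k))).

(* The exponent of the leading digit.  It is [0] when [`|r| < 1], where the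
   integer part is written as the single digit 0. *)
Definition lead_exp r : nat := trunc_log 2 (Num.truncn `|r|).

Definition base2 r (i : nat) : bool := bit r ((lead_exp r)%:Z - i%:Z).

Definition VCdim_real r : \bar int := VCdim (base2 r).

Let truncn_double (y : R) : 0 <= y ->
  Num.truncn (y * 2) = ((Num.truncn y).*2 + odd (Num.truncn (y * 2)))%N.
Proof.
move=> y0; rewrite -[LHS]odd_double_half addnC; congr (_.*2 + _)%N.
have /andP[h1 h2] := truncn_itv y0.
have /andP[h3 h4] : (Num.truncn (y * 2))%:R <= y * 2 < (Num.truncn (y * 2)).+1%:R.
  by apply: truncn_itv; rewrite mulr_ge0.
apply/esym/eqP; rewrite truncn_eq //.
set t := Num.truncn (y * 2) in h3 h4 *.
apply/andP; split.
  rewrite -(ler_pM2r (ltr0n R 2)) (le_trans _ h3)// -natrM ler_nat muln2.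
  by rewrite -[leqRHS]odd_double_half leq_addl.
rewrite -(ltr_pM2r (ltr0n R 2)) (lt_le_trans h4)// -natrM ler_nat muln2 doubleS.
by rewrite -[in leqLHS](odd_double_half t); case: (odd t).
Qed.

Let truncn_lead r : (Num.truncn (`|r| * 2 ^ (- (lead_exp r)%:Z)) <= 1)%N.
Proof.
rewrite -ltnS truncn_lt_nat ?mulr_ge0 ?exprz_ge0//.
rewrite -invr_expz ltr_pdivrMr ?exprz_gt0// -exprnP -exprS.
rewrite -natrX -truncn_lt_nat//.
rewrite /lead_exp.
by case: (Num.truncn _) => [|m]; rewrite ?expn_gt0// trunc_log_ltn.
Qed.

Let base2_sum r n :
  \sum_(i < n.+1) (base2 r i)%:R * 2 ^ ((lead_exp r)%:Z - i%:Z) =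
  (Num.truncn (`|r| * 2 ^ (n%:Z - (lead_exp r)%:Z)))%:R
    * 2 ^ ((lead_exp r)%:Z - n%:Z) :> R.
Proof.
have n2 : (2 : R) != 0 by rewrite pnatr_eq0.
elim: n => [|n IH].
  rewrite big_ord1 /base2 /bit /= subr0 sub0r; congr (_%:R * _).
  by have := truncn_lead r; case: (Num.truncn _) => [|[|]].
rewrite big_ord_recr /= IH /base2 /bit opprB.
have E : `|r| * 2 ^ (n.+1%:Z - (lead_exp r)%:Z)
         = `|r| * 2 ^ (n%:Z - (lead_exp r)%:Z) * 2 :> R.
  by rewrite -mulrA intS -addrA [1 + _]addrC expfzDr// expr1z.
have F : 2 ^ ((lead_exp r)%:Z - n%:Z) = 2 * 2 ^ ((lead_exp r)%:Z - n.+1%:Z) :> R.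
  by rewrite -[X in X * _]expr1z -expfzDr// intS opprD addrCA [1 + _]addrA subrr add0r.
rewrite [in RHS]E truncn_double ?mulr_ge0 ?exprz_ge0// -E F mulrA -mulrDl.
by congr (_ * _); rewrite natrD -muln2 natrM.
Qed.

(* The digits sum to [`|r|]; strictness of the upper bound excludes an expansion
   ending in infinitely many ones. *)
Lemma base2_remainder r n :
  0 <= `|r| - \sum_(i < n.+1) (base2 r i)%:R * 2 ^ ((lead_exp r)%:Z - i%:Z)
    < 2 ^ ((lead_exp r)%:Z - n%:Z).
Proof.
rewrite base2_sum; set t := Num.truncn _.
have p : 0 < 2 ^ ((lead_exp r)%:Z - n%:Z) :> R by rewrite exprz_gt0.
have /andP[h1 h2] : t%:R <= `|r| * 2 ^ (n%:Z - (lead_exp r)%:Z) < t.+1%:R.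
  by apply: truncn_itv; rewrite mulr_ge0 ?exprz_ge0.
rewrite -opprB -invr_expz in h1 h2.
rewrite ler_pdivlMr// in h1; rewrite ltr_pdivrMr// in h2.
by rewrite subr_ge0 h1/= ltrBlDr -{1}[2 ^ _]mul1r -mulrDl nat1r.
Qed.

Lemma base2_lead r : 1 <= `|r| -> base2 r 0.
Proof.
move=> r1; rewrite /base2 /bit subr0.
suff: (0 < Num.truncn (`|r| * 2 ^ (- (lead_exp r)%:Z)))%N.
  by have := truncn_lead r; case: (Num.truncn _) => [|[|]].
rewrite truncn_ge_nat ?mulr_ge0 ?exprz_ge0//.
rewrite -invr_expz ler_pdivlMr ?exprz_gt0// mul1r -exprnP -natrX -truncn_ge_nat//.
by rewrite trunc_logP// truncn_ge_nat.
Qed.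

End BinaryExpansion.

(* Main.v *)
(* If [VCdim S <= 1], then [S (p + delta) -> S p] for some [delta > 0]: take for
   [delta] the distance between two ones.  Hence [S] is nonincreasing along every
   residue class modulo [delta], and there are only countably many such strings.
   For [d >= 2], a string whose ones sit at powers of 2 has pairwise distinct
   differences between its ones, which rules out shattered triples; there are as
   many such strings as subsets of [nat]. *)
Require Import Defs.
From mathcomp Require Import all_boot all_order all_algebra.
From mathcomp Require Import all_classical all_reals.
From mathcomp Require Import zify lra.
Import Order.TTheory GRing.Theory Num.Theory.
Local Open Scope classical_set_scope.
Local Open Scope ring_scope.

(** * Shattering by the substrings of one string *)

Lemma ones_substringE (S : nat -> bool) (i n k : nat) :
  ones (substring S i n) k <-> (k < n)%N /\ S (i + k)%N.
Proof.
rewrite /ones /substring /=; case: (ltnP k n) => kn.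
  by rewrite nth_mkseq //; split=> [|[]].
by rewrite nth_default ?size_mkseq//; split=> [|[]].
Qed.

Lemma shattered_sizes0 (S : nat -> bool) :
  shattered_sizes (substring_class S) 0.
Proof.
exists set0; first by rewrite II0.
rewrite /shattered; apply/seteqP; split=> A /=.
  by move=> [c _ <-]; rewrite setI0.
rewrite subset0 => ->; exists (ones (substring S 0 0)); last by rewrite setI0.
by exists 0%N, 0%N.
Qed.

(** The empty set is always shattered, so a bound on the sizes yields a largest one and rules out
    the default [+oo]. *)
Lemma VCdim_leP (S : nat -> bool) (d : nat) :
  (VCdim S <= (d%:Z)%:E)%E <->
  forall k, shattered_sizes (substring_class S) k -> (k <= d)%N.
Proof.
rewrite /VCdim; set A := shattered_sizes _; split.
  case: xgetP => [_ -> [k [_ kmax] <-]|_]; last by rewrite leye_eq.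
  by rewrite lee_fin lez_nat => kd j /kmax /leq_trans; apply.
move=> Ad; have exA : exists k, `[<A k>].
  by exists 0%N; apply/asboolP/shattered_sizes0.
have ubA k : `[<A k>] -> (k <= d)%N by move=> /asboolP /Ad.
case: (ex_maxnP exA ubA) => k /asboolP Ak kmax.
have kL : largest A k by split=> // j Aj; apply/kmax/asboolP.
have [j [Aj _] <-] := xgetI +oo%E (imageP (fun k => (k%:Z)%:E) kL).
by rewrite lee_fin lez_nat; apply: Ad.
Qed.

(** The shattered set is [{0, delta}]: substrings starting at [q] give the traces containing 0, one
    starting at [p] gives [{delta}], and the empty one gives the rest. *)
Lemma shattered_pair (S : nat -> bool) (delta p q : nat) : (0 < delta)%N ->
  ~~ S p -> S (p + delta)%N -> S q -> S (q + delta)%N ->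
  shattered_sizes (substring_class S) 2.
Proof.
move=> d0 Sp Spd Sq Sqd.
exists (muln delta @` `I_2).
  by apply: inj_card_eq => x y _ _ /eqP; rewrite eqn_pmul2l// => /eqP.
have -> : muln delta @` `I_2 = [set 0%N; delta].
  apply/seteqP; split=> x /=.
    by move=> [[|[|//]] _ <-]; [left; rewrite muln0|right; rewrite muln1].
  by move=> [->|->]; [exists 0%N => //; rewrite muln0|exists 1%N => //; rewrite muln1].
rewrite /shattered; apply/seteqP; split=> A /=; first by move=> [c _ <-] x [].
move=> AB.
suff [i [n [H0 Hd]]] : exists i n, (A 0%N <-> (0 < n)%N /\ S i) /\
    (A delta <-> (delta < n)%N /\ S (i + delta)%N).
  exists (ones (substring S i n)); first by exists i, n.
  apply/seteqP; split=> x.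
    move=> [/ones_substringE[xn Sx]] /= [xE|xE]; subst x.
      by apply/H0; rewrite addn0 in Sx.
    exact/Hd.
  move=> Ax; split; last exact: AB.
  by apply/ones_substringE; case: (AB _ Ax) => /= xE; subst x;
     [rewrite addn0; apply/H0|apply/Hd].
have [A0|A0] := pselect (A 0%N); have [Ad|Ad] := pselect (A delta).
- by exists q, delta.+1.
(* Length 1 cuts off [delta], which is positive. *)
- by exists q, 1%N; rewrite ltnS leqn0; split; split=> // -[] /eqP; lia.
- by exists p, delta.+1; split; split=> // -[_]; rewrite (negbTE Sp).
- by exists 0%N, 0%N; split; split=> // -[].
Qed.

(* If [S] has a single one, at [q], then [delta = q + 1] works vacuously. *)
Lemma VCdim_le1_shift (S : nat -> bool) : (VCdim S <= (1%:Z)%:E)%E ->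
  exists2 delta, (0 < delta)%N & forall p, S (p + delta)%N -> S p.
Proof.
move=> /VCdim_leP V1.
have [[q [delta [d0 [Sq Sqd]]]]|nopair] :=
    pselect (exists q delta, (0 < delta)%N /\ S q /\ S (q + delta)%N).
  exists delta => // p Spd; apply/negPn/negP => Sp.
  by have := V1 _ (shattered_pair S delta p q d0 Sp Spd Sq Sqd).
have [[q Sq]|none] := pselect (exists q, S q); last first.
  by exists 1%N => // p Sp; case: none; eexists; exact: Sp.
exists q.+1 => // p Sp; case: nopair; exists q, p.+1; do 2!split=> //.
by rewrite addnS addnC -addnS.
Qed.

(* Along residue [r] modulo [size c], the [r]-th entry of [c] tells after how
   many ones the string drops to zero, [None] meaning never. *)
Definition staircase (c : seq (option nat)) (i : nat) : bool :=
  if nth None c (i %% size c) is Some m then (i %/ size c < m)%N else true.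

(** The code [c] lies in a countable type, which is what bounds the number of such strings. *)
Lemma shift_staircase (S : nat -> bool) (delta : nat) : (0 < delta)%N ->
  (forall p, S (p + delta)%N -> S p) -> exists c, S = staircase c.
Proof.
move=> d0 Sshift.
have /choice[t tP] : forall r, exists t : option nat, forall k,
    S (k * delta + r)%N = if t is Some m then (k < m)%N else true.
  move=> r; have [allS|] := pselect (forall k, S (k * delta + r)%N).
    by exists None.
  move=> /existsNP[k0 /negP Sk0].
  have ex0 : exists k, ~~ S (k * delta + r)%N by exists k0.
  case: (ex_minnP ex0) => m Sm mmin; exists (Some m) => k.
  case: (ltnP k m) => km; first by apply/negPn/negP => /mmin; lia.
  (* By the shift hypothesis, the first zero [m] of a residue class propagates to all later
     terms. *)
  rewrite -(subnK km); elim: (k - m)%N => [|j IH]; first by rewrite (negbTE Sm).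
  apply/negbTE/negP => Sj; move/negP: IH; apply; apply: Sshift.
  by move: Sj; congr (is_true (S _)); lia.
exists (mkseq t delta); apply/funext => i; rewrite /staircase size_mkseq.
by rewrite nth_mkseq ?ltn_pmod// {1}(divn_eq i delta) tP.
Qed.

(** * Passing between reals and digit strings *)

Section Reals.
Variable R : realType.
Implicit Types r : R.

(** Digits alone forget the sign and the binary point; with these restored, [base2_remainder] puts
    both absolute values in a common dyadic interval of arbitrarily small length. *)
Lemma base2_inj r r' : (0 <= r) = (0 <= r') -> lead_exp r = lead_exp r' ->
  base2 r = base2 r' -> r = r'.
Proof.
move=> sgn lead bits; suff nE : `|r| = `|r'|.
  have [r0|r0] := leP 0 r.
    by move: nE; rewrite !ger0_norm -?sgn.
  have r'0 : r' < 0 by rewrite ltNge -sgn -ltNge.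
  by move: nE; rewrite !ltr0_norm// => /oppr_inj.
apply/eqP/negPn/negP; rewrite -subr_eq0 -normr_gt0 => e0.
set e := `|_| in e0.
suff le n : e < 2 ^ ((lead_exp r)%:Z - n%:Z).
  (* This index makes the bound [2 ^ (- k)] with [k] the successor of the integer part of [e^-1]; it
     is at most [e] since [e^-1 <= k < 2 ^ k]. *)
  have := le (lead_exp r + Num.truncn e^-1).+1.
  have -> : (lead_exp r)%:Z - (lead_exp r + Num.truncn e^-1).+1%:Z
          = - (Num.truncn e^-1).+1%:Z by lia.
  rewrite -invr_expz ltNge => /negP; apply.
  rewrite invf_ple ?posrE ?exprz_gt0//.
  have ei0 : 0 <= e^-1 by rewrite invr_ge0 ltW.
  have /andP[_ /ltW /le_trans] := truncn_itv ei0; apply.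
  by rewrite -exprnP -natrX ler_nat ltnW// ltn_expl.
have := base2_remainder r n; have := base2_remainder r' n.
rewrite -lead -bits /e; set s := \sum_(_ < _) _; set E := 2 ^ _.
move=> /andP[h1 h2] /andP[h3 h4]; rewrite ltr_norml; apply/andP; split; lra.
Qed.

Lemma countable_VCdim_le1 : countable [set r : R | (VCdim_real r <= (1%:Z)%:E)%E].
Proof.
(* [g] decodes sign, leading exponent and staircase code; the default 0 on triples coding no real
   only risks enlarging the range. *)
pose g (x : bool * nat * seq (option nat)) : R :=
  xget 0 [set r | [/\ (0 <= r) = x.1.1, lead_exp r = x.1.2
                    & base2 r = staircase x.2]].
apply: (@sub_countable _ _ _ (range g)); last first.
  exact: (card_le_trans (card_image_le _ _) (countableP _)).
apply: subset_card_le => r /= /VCdim_le1_shift[delta d0 /(shift_staircase _ _ d0)[c cE]].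
exists (0 <= r, lead_exp r, c) => //; rewrite /g /=.
case: xgetP => [r' _ [h1 h2 h3]|/(_ r)]; last by case.
by apply: base2_inj => //; rewrite h3.
Qed.

Fixpoint digits_nat (S : nat -> bool) (n : nat) : nat :=
  if n is m.+1 then ((digits_nat S m).*2 + S n)%N else S 0%N.

(** The real is the common point of the nested dyadic intervals from [lo n] to [hi n]. *)
Lemma base2_onto (S : nat -> bool) : S 0%N = false ->
  (forall n, exists2 m, (n < m)%N & ~~ S m) -> exists r, base2 r = S.
Proof.
move=> S0 Szeros; pose N := digits_nat S.
have p2 n : 0 < 2 ^+ n :> R by rewrite exprn_gt0.
pose lo n : R := (N n)%:R / 2 ^+ n; pose hi n : R := (N n).+1%:R / 2 ^+ n.
have NS n : (N n.+1)%:R = (N n)%:R * 2 + (S n.+1)%:R :> R.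
  by rewrite /N /= natrD -muln2 natrM.
have loS n : lo n <= lo n.+1.
  rewrite /lo ler_pdivrMr// exprS invfM mulrA mulfVK ?gt_eqF//.
  by rewrite ler_pdivlMr// NS lerDl.
have hiS n : hi n.+1 + (~~ S n.+1)%:R / 2 ^+ n.+1 = hi n.
  rewrite /hi -mulrDl -[(N n.+1).+1%:R]natr1 NS exprS invfM mulrA.
  congr (_ / _); rewrite -[(N n).+1%:R]natr1; case: (S _) => /=; lra.
have hi_le n : hi n.+1 <= hi n by rewrite -(hiS n) lerDl divr_ge0// ltW.
have lomono : {homo lo : m n / (m <= n)%N >-> m <= n}
    by apply: homo_leq => // y x z; apply: le_trans.
have himono : {homo hi : m n / (m <= n)%N >-> n <= m}.
  by apply: (@homo_leq _ _ (fun x y => y <= x)) => // y x z /[swap]; apply: le_trans.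
have lohi m n : lo m <= hi n.
  apply: (le_trans (lomono _ _ (leq_maxl m n))).
  apply: le_trans (himono _ _ (leq_maxr m n)).
  by rewrite /lo /hi ler_pM2r ?invr_gt0// ler_nat.
pose r := sup (range lo).
have lor n : lo n <= r.
  apply: ub_le_sup; last by exists n.
  by exists (hi 0%N) => _ [m _ <-].
have rhi n : r <= hi n by apply: ge_sup => [|_ [m _ <-]//]; exists (lo 0%N), 0%N.
(* A zero digit after position [n] strictly lowers the upper endpoint, so the integer part of
   [r * 2 ^+ n] is exactly [N n]. *)
have rhi_lt n : r < hi n.
  have [[//|m] nm Sm] := Szeros n.
  apply: lt_le_trans (himono n m _); last by [].
  by apply: (le_lt_trans (rhi m.+1)); rewrite -(hiS m) Sm ltrDl mul1r invr_gt0.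
have r0 : 0 <= r by apply: le_trans (lor 0%N); rewrite divr_ge0.
have truncE n : Num.truncn (r * 2 ^+ n) = N n.
  apply/eqP; rewrite truncn_eq ?mulr_ge0 ?exprn_ge0//.
  by rewrite -ler_pdivrMr// -ltr_pdivlMr// lor rhi_lt.
exists r; apply/funext => n.
(* As [S 0] is false, the integer part of [r] is 0, hence [lead_exp r] is 0 and the positions need
   no shift. *)
have -> : base2 r n = odd (N n).
  rewrite /base2 /bit /lead_exp ger0_norm//.
  have := truncE 0%N; rewrite mulr1 /N /= S0 => ->.
  by rewrite trunc_log0 sub0r opprK -exprnP truncE.
by case: n => [|n]; rewrite /N /= ?oddD ?odd_double /=; [case: (S _)|case: (S _)].
Qed.


End Reals.

(** * Sidon strings and ones at powers of 2 *)

Definition sidon (S : nat -> bool) : Prop := forall x y delta,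
  (0 < delta)%N -> S x -> S (x + delta)%N -> S y -> S (y + delta)%N -> x = y.

(* If [a < b < c] were shattered, the two occurrences of ones at distance
   [c - b] needed for the traces [{a, b, c}] and [{b, c}] would coincide. *)
Lemma sidon_VCdim_le2 (S : nat -> bool) : sidon S ->
  (VCdim S <= (2%:Z)%:E)%E.
Proof.
move=> SS; apply/VCdim_leP => k [B Bk sh]; rewrite leqNgt; apply/negP => k3.
have no3 a b c : B a -> B b -> B c -> (a < b)%N -> (b < c)%N -> False.
  move=> Ba Bb Bc ab bc; move/seteqP: sh => [_ sh].
  have [_ [i [n ->]] iE] := sh B (fun _ => id).
  have [_ [j [m ->]] jE] := sh (B `\ a) (@subDsetl _ _ _).
  have onB x : B x -> S (i + x)%N.
    by rewrite -[X in X x]iE => -[/ones_substringE[]].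
  have onD x : B x -> x != a -> (x < m)%N /\ S (j + x)%N.
    move=> Bx xa; have : (B `\ a) x by split=> //; apply/eqP.
    by rewrite -jE => -[/ones_substringE].
  have [_ jb] := onD b Bb ltac:(lia); have [cm jc] := onD c Bc ltac:(lia).
  have ijb : (i + b = j + b)%N.
    apply: (SS (i + b)%N (j + b)%N (c - b)%N); rewrite -?addnA ?subnKC ?subn_gt0 ?(ltnW bc)//.
    - exact: onB.
    - exact: onB.
  have ij : i = j by lia.
  (* The window at [j] reaches past [c], hence covers [a], and [i = j] puts a one there. *)
  have : (B `\ a) a.
    by rewrite -jE; split=> //; apply/ones_substringE; split; [lia|rewrite -ij; apply: onB].
  by case=> _; apply.
have : (`I_3 #<= B)%card by rewrite (card_le_eqr Bk) card_le_II.
move=> /pcard_leP[f].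
have fB x : (x < 3)%N -> B (f x) by exact: (@funS _ _ `I_3 B f).
have fI x y : (x < 3)%N -> (y < 3)%N -> f x = f y -> x = y.
  by move=> x3 y3; apply: (@inj _ _ `I_3 f); rewrite inE.
have [B0 B1 B2] := And3 (fB 0%N isT) (fB 1%N isT) (fB 2%N isT).
(* The injection [f] need not be increasing, so every order of its three values is treated. *)
case: (ltngtP (f 0%N) (f 1%N)) => [h01|h01|/(fI 0%N 1%N isT isT)//];
  case: (ltngtP (f 0%N) (f 2%N)) => [h02|h02|/(fI 0%N 2%N isT isT)//];
  case: (ltngtP (f 1%N) (f 2%N)) => [h12|h12|/(fI 1%N 2%N isT isT)//];
  by [eauto | lia].
Qed.

(** This is [2 ^ m - 2 ^ n = 2 ^ m' - 2 ^ n'] without subtraction. If [n < n'], dividing by [2 ^ n]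
    leaves an even left side and an odd right side. *)
Lemma expn2_sub_inj (n m n' m' : nat) : (n < m)%N -> (n' < m')%N ->
  (2 ^ m + 2 ^ n' = 2 ^ m' + 2 ^ n)%N -> n = n'.
Proof.
wlog nn' : n m n' m' / (n < n')%N => [wl nm nm' e|].
  by case: (ltngtP n n') => // h; [apply: wl e|apply/esym; apply: (wl n' m' n m)].
move=> nm n'm' e; exfalso.
have split2 k : (n < k)%N -> (2 ^ k = (2 ^ n) * (2 ^ (k - n.+1)).*2)%N.
  by move=> nk; rewrite -muln2 -expnSr -expnD; congr (2 ^ _)%N; lia.
move: e; rewrite (split2 m)// (split2 n')// (split2 m') ?(ltn_trans nn')//.
rewrite -[X in _ = (_ + X)%N](muln1 (2 ^ n)%N) -!mulnDr => /eqP.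
by rewrite eqn_pmul2l ?expn_gt0// => /eqP; lia.
Qed.

(* The test [i == 2 ^ _] also discards [i = 0], since [trunc_log 2 0 = 0]. *)
Definition pow2_string (A : nat -> bool) (i : nat) : bool :=
  (i == 2 ^ trunc_log 2 i)%N && A (trunc_log 2 i).

Lemma pow2_string_expn (A : nat -> bool) (n : nat) : pow2_string A (2 ^ n)%N = A n.
Proof. by rewrite /pow2_string trunc_expnK// eqxx. Qed.

Lemma pow2_stringP (A : nat -> bool) (i : nat) :
  pow2_string A i -> exists n, i = (2 ^ n)%N.
Proof. by move=> /andP[/eqP iE _]; exists (trunc_log 2 i). Qed.

Lemma pow2_string_sidon (A : nat -> bool) : sidon (pow2_string A).
Proof.
move=> x y delta d0 /pow2_stringP[n xE] /pow2_stringP[m xdE].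
move=> /pow2_stringP[n' yE] /pow2_stringP[m' ydE].
rewrite xE yE; congr (2 ^ _)%N; apply: (@expn2_sub_inj n m n' m').
- by rewrite -(@ltn_exp2l 2)//; lia.
- by rewrite -(@ltn_exp2l 2)//; lia.
- lia.
Qed.

(** Supplies the infinitely many zeros that [base2_onto] requires. *)
Lemma pow2_string_odd (A : nat -> bool) (n : nat) : ~~ pow2_string A n.*2.+3.
Proof.
apply/negP => /pow2_stringP[[|k]]; first by lia.
by rewrite expnS; lia.
Qed.

Lemma uncountable_VCdim_le2 (R : realType) :
  ~ countable [set r : R | (VCdim_real r <= (2%:Z)%:E)%E].
Proof.
move=> /countable_injP[f finj].
have /choice[h hE] (A : nat -> bool) : exists r : R, base2 r = pow2_string A.
  apply: base2_onto => // n; exists n.*2.+3; first by lia.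
  exact: pow2_string_odd.
have hV A : h A \in [set r : R | (VCdim_real r <= (2%:Z)%:E)%E].
  rewrite inE /= /VCdim_real hE; exact/sidon_VCdim_le2/pow2_string_sidon.
have fhinj A A' : f (h A) = f (h A') -> A = A'.
  move=> /(finj _ _ (hV A) (hV A')) hh; apply/funext => n.
  by rewrite -(pow2_string_expn A) -(pow2_string_expn A') -!hE hh.
(* Cantor's diagonal: [D] collects the codes [f (h A)] at which [A] itself is false. *)
pose D n := `[< exists2 A, f (h A) = n & ~~ A n >].
have : D (f (h D)) <-> ~ D (f (h D)).
  split=> [/asboolP[A /fhinj -> /negP]//|/negP nD].
  by apply/asboolP; exists D.
by tauto.
Qed.

Theorem theorem3 (R : realType) (d : nat) :
  ~ countable [set r : R | (VCdim_real r <= (d%:Z)%:E)%E] <-> (2 <= d)%N.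
Proof.
(* By monotonicity in the bound, only the cases 1 and 2 have to be settled. *)
have mono (m n : nat) : (m <= n)%N ->
    countable [set r : R | (VCdim_real r <= (n%:Z)%:E)%E] ->
    countable [set r : R | (VCdim_real r <= (m%:Z)%:E)%E].
  move=> mn; apply: sub_countable; apply: subset_card_le => r /= /le_trans; apply.
  by rewrite lee_fin lez_nat.
split=> [nc|d2 /(mono _ _ d2)]; last exact: uncountable_VCdim_le2.
rewrite ltnNge; apply/negP => d1; apply/nc/(mono _ _ d1)/countable_VCdim_le1.
Qed.
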